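(* Let $G$ be a group and let $A$ be a finite-dimensional vector space over a field $K$. Let $\Sigma \subset A^G$ be a linear-sofic subshift (e.g., a linear subshift of finite type) and let $\tau \colon \Sigma \to \Sigma$ be a linear cellular automaton, with limit set $\Omega(\tau) = \bigcap_{n \geq 1} \tau^n(\Sigma)$. Then the following conditions are equivalent: (a) $\tau$ is nilpotent; (b) $\Omega(\tau) = \{0\}$.
   Context: For a $K$-vector space $A$, $A^G$ is the $K$-vector space of all maps $x \colon G \to A$, equipped with the prodiscrete topology (product topology with each factor $A$ discrete) and with the shift action $(gx)(h) = x(g^{-1}h)$. A linear subshift of $A^G$ is a closed $G$-invariant vector subspace of $A^G$. It is of finite type (a linear SFT) if it equals $\{x \in A^G : (g^{-1}x)|_D \in P \text{ for all } g \in G\}$ for some finite $D \subset G$ and some $P \subset A^D$. For $K$-vector spaces $A, B$, a linear cellular automaton $B^G \to A^G$ is a map $\tilde\tau$ for which there exist a finite subset $M \subset G$ and a $K$-linear map $\mu \colon B^M \to A$ with $\tilde\tau(x)(g) = \mu((g^{-1}x)|_M)$ for all $x \in B^G$, $g \in G$. A linear cellular automaton $\tau \colon \Sigma \to \Sigma$ is a map that is the restriction of a linear cellular automaton $A^G \to A^G$. A linear subshift $\Sigma \subset A^G$ is linear-sofic if there exist a $K$-vector space $B$, a linear SFT $\Sigma' \subset B^G$, and a linear cellular automaton $\sigma \colon B^G \to A^G$ with $\sigma(\Sigma') = \Sigma$. A map $f \colon X \to X$ is nilpotent if there exist a constant map $c \colon X \to X$ and an integer $n_0 \geq 1$ such that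 $f^{n_0} = c$ and hence $f^n = c$ for all $n \geq n_0$ (for linear $f$ this means $f^{n_0} = 0$ for some $n_0 \ge 1$). *)

(* Defs.v *)
From HB Require Import structures.
From mathcomp Require Import all_boot all_order all_algebra.
From mathcomp Require Import all_classical.
From mathcomp Require Import topology.

Set Implicit Arguments.
Unset Strict Implicit.
Unset Printing Implicit Defensive.

Import GRing.Theory.

Local Open Scope classical_set_scope.
Local Open Scope ring_scope.

Section Subshifts.
Variables (G : groupType) (K : fieldType).

Definition shift (A : Type) (g : G) (x : G -> A) : G -> A :=
  fun h => x (g^-1 * h)%g.

(* [G -> A] carries no canonical topology when [A] is a bare vector space; the
   type ascription selects the product topology with discrete factors. *)
Definition prodiscrete_closed (A : lmodType K) (S : set (G -> A)) : Prop :=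
  closed (S : set {ptws G -> discrete_topology A}).

Definition linear_subshift (A : lmodType K) (S : set (G -> A)) : Prop :=
  [/\ prodiscrete_closed S,
      forall g x, S x -> S (shift g x) &
      GRing.submod_closed (mem S)].

(* [sigL D x] is the restriction of [x] to [D], as a map on the subtype of
   elements of [D]. *)
Definition finite_type (A : Type) (S : set (G -> A)) : Prop :=
  exists (D : set G) (P : set (D -> A)),
    finite_set D /\ S = [set x | forall g, P (sigL D (shift g^-1%g x))].

Definition linear_SFT (A : lmodType K) (S : set (G -> A)) : Prop :=
  linear_subshift S /\ finite_type S.

Definition linear_CA (B A : lmodType K) (t : (G -> B) -> (G -> A)) : Prop :=
  exists (M : set G) (mu : {linear (M -> B) -> A}),
    finite_set M /\ forall x g, t x g = mu (sigL M (shift g^-1%g x)).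

Definition linear_CA_on (A : lmodType K) (S : set (G -> A)) (tau : S -> S) :
    Prop :=
  exists2 t : (G -> A) -> (G -> A),
    linear_CA t & forall x : S, \val (tau x) = t (\val x).

Definition linear_sofic (A : lmodType K) (S : set (G -> A)) : Prop :=
  linear_subshift S /\
  exists (B : lmodType K) (S' : set (G -> B)) (s : (G -> B) -> (G -> A)),
    [/\ linear_SFT S', linear_CA s & s @` S' = S].

End Subshifts.

Definition nilpotent_map (X : Type) (f : X -> X) : Prop :=
  exists (c : X) (n0 : nat), (1 <= n0)%N /\ iter n0 f = cst c.

Definition limit_set (X : Type) (f : X -> X) : set X :=
  \bigcap_(n in [set n | (1 <= n)%N]) range (iter n f).

(* Main.v *)
From HB Require Import structures.
Require Import Defs.
From mathcomp Require Import all_boot all_order all_algebra.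
From mathcomp Require Import all_classical.
From mathcomp Require Import topology.

(* Only the closedness of the subshift S matters, by linear duality. Finitely
   supported linear functionals on A^G separate S from the points outside it,
   and, A being finite-dimensional, every linear functional on the space of
   such functionals is the evaluation at a point of A^G. If some coordinate
   functional l0 is killed by no iterate tau^n, the functionals l with l tau^n = 0
   on S for some n form a subspace missing l0; a linear form vanishing on it and
   equal to 1 at l0 is the evaluation at some y <> 0, and extending the form
   l tau^n |-> l(y) gives a preimage of y under tau^n in S. So a zero limit set
   forces each of the finitely many coordinates at the identity of G to be killed
   by some iterate, and shift invariance concludes. *)

Set Implicit Arguments.
Unset Strict Implicit.
Unset Printing Implicit Defensive.

Import GRing.Theory.

Local Open Scope classical_set_scope.
Local Open Scope ring_scope.

(** * Extension of linear functionals from a subspace *)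

Section Extension.
Variables (K : fieldType) (V : lmodType K).

(** A linear functional on a subspace of [V], kept as a relation so that it can be prescribed before
    it is known to be single-valued; by linearity only the fibre over 0 needs checking. *)
Definition functional_graph (R : set (V * K)) : Prop :=
  [/\ R (0, 0),
      forall a p q, R p -> R q -> R (a *: p.1 + q.1, a * p.2 + q.2) &
      forall c, R (0, c) -> c = 0].

Lemma functional_graph_fun R u c d :
  functional_graph R -> R (u, c) -> R (u, d) -> c = d.
Proof.
move=> [_ Rlin R0] Rc Rd; have := Rlin (-1) _ _ Rd Rc => /=.
by rewrite scaleN1r addNr mulN1r addrC => /R0/eqP; rewrite subr_eq0 => /eqP.
Qed.

(** Extends the functional to the span of its domain and [v] by giving [v] the value 0. *)
Definition adjoin_point (R : set (V * K)) (v : V) : set (V * K) :=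
  [set p | exists a : K, R (p.1 - a *: v, p.2)].

Lemma functional_graph_adjoin_point R v :
  functional_graph R -> (forall c, ~ R (v, c)) ->
  functional_graph (adjoin_point R v).
Proof.
move=> [R00 Rlin R0] Nv; split => [|a [u c] [w d] [b Rb] [e Re]|c [a]] /=.
- by exists 0; rewrite /= scale0r subr0.
- exists (a * b + e) => /=; have := Rlin a _ _ Rb Re => /=.
  congr (R (_, _)).
  by rewrite scalerBr scalerDl opprD scalerA addrACA.
(* If [a] were nonzero, dividing by [-a] would put [v] into the domain of [R]. *)
- rewrite sub0r => Ra; have [a0|a0] := eqVneq a 0.
    by move: Ra; rewrite a0 scale0r oppr0; exact: R0.
  have := Rlin (- a^-1) _ _ Ra R00 => /=.
  by rewrite !addr0 scaleNr scalerN opprK scalerA mulVf// scale1r => /Nv.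
Qed.

Lemma functional_graph_bigcup R (F : set (set (V * K))) :
  functional_graph R -> total_on F subset ->
  (forall X, F X -> functional_graph (R `|` X)) ->
  functional_graph (R `|` \bigcup_(X in F) X).
Proof.
move=> gR Ftot Fg; have [R00 Rlin R0] := gR; split; first by left.
- move=> a p q [Rp|[X FX Xp]] [Rq|[Y FY Yq]].
  + by left; exact: Rlin.
  + have [_ lin _] := Fg _ FY.
    by case: (lin a p q (or_introl Rp) (or_intror Yq)); [left|right; exists Y].
  + have [_ lin _] := Fg _ FX.
    by case: (lin a p q (or_intror Xp) (or_introl Rq)); [left|right; exists X].
  + have [Z [FZ Zp Zq]] : exists Z, [/\ F Z, Z p & Z q].
      case: (Ftot _ _ FX FY) => sub; first by exists Y; split => //; exact: sub.
      by exists X; split => //; exact: sub.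
    have [_ lin _] := Fg _ FZ.
    by case: (lin a p q (or_intror Zp) (or_intror Zq)); [left|right; exists Z].
- move=> c [/R0//|[X FX Xc]]; have [_ _ X0] := Fg _ FX.
  by apply: X0; right.
Qed.

Lemma functional_graph_extension (R : set (V * K)) :
  functional_graph R ->
  exists f : {scalar V}, forall v c, R (v, c) -> f v = c.
Proof.
(* Joining R makes the empty set admissible, as the empty chain requires. *)
move=> gR; pose P X := functional_graph (R `|` X).
have /Zorn_bigcup[M [gM maxM]] : forall F, F `<=` P -> total_on F subset ->
  P (\bigcup_(X in F) X) by move=> F FP Ftot; exact: functional_graph_bigcup.
(* By maximality the domain is all of [V]: adjoining a missing [v] would give a strictly larger
   graph, as it contains [(v, 0)]. *)
have tot v : exists c, (R `|` M) (v, c).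
  apply: contrapT => /forallNP Nv; have := functional_graph_adjoin_point gM Nv.
  have sub : R `|` M `<=` adjoin_point (R `|` M) v.
    by move=> [u c] uc; exists 0; rewrite /= scale0r subr0.
  have adj : R `|` adjoin_point (R `|` M) v = adjoin_point (R `|` M) v.
    by apply/setUidPr => p Rp; apply: sub; left.
  rewrite -adj; apply: maxM; split=> [|/(_ (v, 0)) Mv].
    by move=> p Mp; apply: sub; right.
  apply: (Nv 0); right; apply: Mv; exists 1 => /=.
  by rewrite scale1r subrr; left; case: gR.
have [f Mf] := choice tot.
have flin : scalar f.
  move=> a u v; apply: (functional_graph_fun gM (Mf _)).
  by case: gM => _ lin _; exact: (lin a _ _ (Mf u) (Mf v)).
pose fL := GRing.isLinear.Build _ _ _ _ f flin.
pose g : {scalar V} := HB.pack f fL.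
by exists g => v c Rvc; apply: (functional_graph_fun gM (Mf v)); left.
Qed.

End Extension.

(** * Finitely supported functionals and their duality with configurations *)

Section FinitaryFunctionals.
Variables (G : groupType) (K : fieldType).

(** With [K] discrete, these are the continuous linear functionals for the prodiscrete topology. *)
Definition finitary (A : lmodType K) (l : (G -> A) -> K^o) : Prop :=
  scalar l /\ exists D : seq G, forall x, {in D, forall g, x g = 0} -> l x = 0.

Lemma finitary0 (A : lmodType K) : finitary (0 : (G -> A) -> K^o).
Proof.
by split; [move=> a x y /=; rewrite mulr0 addr0|exists [::]].
Qed.

Lemma finitaryP (A : lmodType K) a (l m : (G -> A) -> K^o) :
  finitary l -> finitary m -> finitary (a *: l + m).
Proof.
move=> [llin [D lD]] [mlin [E mE]]; split=> [b x y|].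
  rewrite !fctE/= llin mlin /GRing.scale/=.
  by rewrite !mulrDr !mulrA (mulrC b a) addrACA.
exists (D ++ E) => x xDE; rewrite !fctE/= lD ?mE ?scaler0 ?addr0// => g gin.
  by apply: xDE; rewrite mem_cat gin orbT.
by apply: xDE; rewrite mem_cat gin.
Qed.

Lemma prodiscrete_closed_approx (A : lmodType K) (S : set (G -> A)) z :
  prodiscrete_closed S ->
  (forall D : seq G, exists2 x, S x & {in D, x =1 z}) -> S z.
Proof.
move=> Scl approx; apply: Scl => U Uz.
(* The filter generated by the cylinders around [z]; it converges to [z]. *)
pose F : set_system (G -> A) :=
  [set W | exists D : seq G, [set x : G -> A | {in D, x =1 z}] `<=` W].
have FF : Filter F.
  split; first by exists [::].
    move=> P Q [D DP] [E EQ]; exists (D ++ E) => x xz; split.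
      by apply: DP => g gD; apply: xz; rewrite mem_cat gD.
    by apply: EQ => g gE; apply: xz; rewrite mem_cat gE orbT.
  by move=> P Q PQ [D DP]; exists D; exact: subset_trans PQ.
have Fz : F --> (z : {ptws G -> discrete_topology A}).
  apply/cvg_sup => g W [V [[W' W'o <-] /= W'z] sub].
  by exists [:: g] => x xz; apply: sub => /=; rewrite /proj xz// mem_head.
have [D DU] : F U by exact: Fz.
by have [x Sx xz] := approx D; exists x; split => //; exact: DU.
Qed.

(** If no point of [S] agreed with [z] on [D], then [x + c z |-> c], read on [D], would be well
    defined; an extension of it is finitary, kills [S] and is 1 at [z]. *)
Lemma closed_submod_separation (A : lmodType K) (S : set (G -> A)) z :
  prodiscrete_closed S -> GRing.submod_closed (mem S) ->
  (forall l, finitary l -> (forall x, S x -> l x = 0) -> l z = 0) -> S z.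
Proof.
move=> Scl [/set_mem S0 Slin] Hz.
have SZ a x y : S x -> S y -> S (a *: x + y).
  by move=> /mem_set Sx /mem_set Sy; apply/set_mem/Slin.
apply: prodiscrete_closed_approx Scl _ => D; apply: contrapT => ND.
pose R : set ((G -> A) * K) :=
  [set p | exists2 x, S x & {in D, forall g, p.1 g = x g + p.2 *: z g}].
have gR : functional_graph R.
  split=> [|a [u c] [v d] [x Sx /= ux] [y Sy /= vy]|c [x Sx xc]].
  - by exists 0 => // g _ /=; rewrite scale0r addr0.
  - exists (a *: x + y); first exact: SZ.
    move=> g gD /=; rewrite !fctE ux// vy//= scalerDr scalerDl scalerA.
    by rewrite addrACA.
  - apply/eqP; apply: contrapT => /negP c0; apply: ND.
    exists (- c^-1 *: x + 0); first exact: SZ.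
    move=> g gD; have /= /esym/eqP := xc g gD; rewrite addr_eq0 => /eqP xg.
    by rewrite !fctE addr0 xg scaleNr scalerN opprK scalerA mulVf// scale1r.
have [f fR] := functional_graph_extension gR.
have f1 : f z = 1.
  by apply: fR; exists 0 => // g _; rewrite /= scale1r add0r.
have := oner_neq0 K; rewrite -f1 Hz ?eqxx//.
  split; first exact: linearP.
  exists D => x xD; apply: fR; exists 0 => // g gD.
  by rewrite /= xD// scale0r addr0.
by move=> x Sx; apply: fR; exists x => // g _; rewrite /= scale0r addr0.
Qed.

Variable A : vectType K.

Let e := vbasis (fullv : {vspace A}).

Definition coordinate (g : G) (i : 'I_(\dim (fullv : {vspace A}))) :
  (G -> A) -> K^o := fun x => coord e i (x g).

Definition dual_coordinate (g : G) (i : 'I_(\dim (fullv : {vspace A}))) : G -> A :=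
  fun h => if h == g then e`_i else 0.

Lemma finitary_coordinate g i : finitary (coordinate g i).
Proof.
split=> [a x y|]; first by rewrite /coordinate fctE/= linearP.
by exists [:: g] => x xg; rewrite /coordinate xg ?mem_head// linear0.
Qed.

Lemma coordinate_inj (x y : G -> A) :
  (forall g i, coordinate g i x = coordinate g i y) -> x = y.
Proof.
move=> xy; apply/funext => g.
rewrite (coord_vbasis (memvf (x g))) (coord_vbasis (memvf (y g))).
by apply: eq_bigr => i _; congr (_ *: _); exact: xy.
Qed.

(** Only values on [D] matter, so [x] may be replaced by the combination of dual coordinates
    agreeing with it there; [undup] makes each position count once. *)
Lemma finitary_sum_coordinate (l : (G -> A) -> K^o) : finitary l ->
  exists D : seq G,
    l = \sum_(g <- D) \sum_i l (dual_coordinate g i) *: coordinate g i.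
Proof.
move=> [llin [D lD]]; exists (undup D); apply/funext => x.
pose fL := GRing.isLinear.Build _ _ _ _ l llin.
pose f : {scalar (G -> A)} := HB.pack l fL.
pose p := \sum_(g <- undup D) \sum_i coordinate g i x *: dual_coordinate g i.
have -> : l x = l p.
  apply/eqP; rewrite -subr_eq0 -[l]/(f : _ -> _) -linearB; apply/eqP/lD => h hD.
  rewrite !fctE /p fct_sumE (bigD1_seq h) ?undup_uniq ?mem_undup//=.
  rewrite [X in _ - (_ + X)]big1 ?addr0 => [|g gh]; last first.
    rewrite fct_sumE big1// => i _.
    by rewrite !fctE /dual_coordinate eq_sym (negbTE gh) scaler0.
  rewrite fct_sumE {1}(coord_vbasis (memvf (x h))); apply/eqP.
  rewrite subr_eq0; apply/eqP/eq_bigr => i _.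
  by rewrite !fctE /dual_coordinate eqxx.
rewrite -[l]/(f : _ -> _) /p linear_sum fct_sumE; apply: eq_bigr => g _.
rewrite linear_sum fct_sumE; apply: eq_bigr => i _.
by rewrite linearZ/= mulrC.
Qed.

(** The coordinates span the finitary functionals, and the values of [L] on them can be taken as the
    coordinates of [y]. *)
Lemma scalar_finitary_eval (L : {scalar ((G -> A) -> K^o)}) :
  exists y, forall l, finitary l -> L l = l y.
Proof.
pose y g := \sum_i L (coordinate g i) *: e`_i.
have yE g i : coordinate g i y = L (coordinate g i).
  by rewrite /coordinate /y coord_sum_free ?(basis_free (vbasisP _)).
exists y => l /finitary_sum_coordinate[D lE].
rewrite {1 2}lE linear_sum fct_sumE; apply: eq_bigr => g _.
rewrite linear_sum fct_sumE; apply: eq_bigr => i _.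
by rewrite linearZ/= -yE.
Qed.

End FinitaryFunctionals.

(** * Linear cellular automata acting on functionals *)

Section LinearCA.
Variables (G : groupType) (K : fieldType).

Lemma linear_CAP (B A : lmodType K) (t : (G -> B) -> (G -> A)) a x y :
  linear_CA t -> t (a *: x + y) = a *: t x + t y.
Proof.
move=> [M [mu [_ tE]]]; apply/funext => g; rewrite !fctE !tE.
by rewrite -linearP; congr (mu _); apply/funext.
Qed.

Lemma linear_CA0 (B A : lmodType K) (t : (G -> B) -> (G -> A)) :
  linear_CA t -> t 0 = 0.
Proof.
move=> tCA; have := linear_CAP (-1) 0 0 tCA.
by rewrite scaler0 addr0 scaleN1r addNr.
Qed.

Lemma linear_CA_shift (B A : lmodType K) (t : (G -> B) -> (G -> A)) g x :
  linear_CA t -> t (shift g x) = shift g (t x).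
Proof.
move=> [M [mu [_ tE]]]; apply/funext => h; rewrite /shift !tE.
by congr (mu _); apply/funext => k; rewrite /sigL /shift /comp !invgK !mulgA.
Qed.

Lemma finitary_linear_CA (B A : lmodType K) (t : (G -> B) -> (G -> A)) l :
  linear_CA t -> finitary l -> finitary (l \o t : (G -> B) -> K^o).
Proof.
move=> tCA [llin [D lD]]; split=> [a x y|].
  by rewrite /= (linear_CAP _ _ _ tCA) llin.
case: tCA => M [mu [/finite_seqP[s ME] tE]].
(* The value of [t x] at [g] depends on [x] only on the translate of [M] by [g]. *)
exists [seq (g * h)%g | g <- D, h <- s] => x x0 /=; apply: lD => g gD.
rewrite tE -[RHS](linear0 mu); congr (mu _); apply/funext => -[h hM] /=.
rewrite /shift invgK; apply/x0/allpairsP; exists (g, h); split => //=.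
by move/set_mem: hM; rewrite ME.
Qed.

Variable A : vectType K.
Variables (S : set (G -> A)) (t : (G -> A) -> (G -> A)).
Hypothesis S_closed : prodiscrete_closed S.
Hypothesis S_submod : GRing.submod_closed (mem S).
Hypothesis tCA : linear_CA t.
Hypothesis tS : forall x, S x -> S (t x).

Lemma finitary_iter_CA n l : finitary l -> finitary (l \o iter n t).
Proof.
elim: n l => [//|n IH] l fl.
exact: (IH _ (finitary_linear_CA tCA fl)).
Qed.

Lemma iter_CA_stable n x : S x -> S (iter n t x).
Proof. by move=> Sx; elim: n => //= n; exact: tS. Qed.

Lemma iter_image_lift (y : G -> A) n :
  (forall l, finitary l -> (forall x, S x -> l (iter n t x) = 0) -> l y = 0) ->
  exists2 z, S z & iter n t z = y.
Proof.
move=> yann.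
(* Prescribes [l \o iter n t |-> l y], with functionals compared on [S] only; [yann] makes this
   single-valued. *)
pose R : set (((G -> A) -> K^o) * K) := [set p | exists l,
  [/\ finitary l, forall x, S x -> p.1 x = l (iter n t x) & p.2 = l y]].
have gR : functional_graph R.
  split=> [|a [p c] [q d] [l [fl /= pl cl]] [m [fm /= qm dm]]|c [l [fl /= l0 ->]]].
  - by exists 0; split => //; exact: finitary0.
  - exists (a *: l + m); split=> [|x Sx /=|].
    + exact: finitaryP.
    + by rewrite !fctE/= pl// qm.
    + by rewrite /= cl dm.
  - by apply: yann => // x /l0.
have [L LR] := functional_graph_extension gR.
have [z Lz] := scalar_finitary_eval L.
exists z.
  (* Taking the functional 0 in [R] shows that whatever vanishes on [S] is sent to 0, so [z] lies in
     [S]. *)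
  apply: (closed_submod_separation S_closed S_submod) => l fl l0.
  by rewrite -Lz//; apply: LR; exists 0; split => //; exact: finitary0.
apply: coordinate_inj => g i.
have fl := finitary_coordinate g i.
have := Lz _ (finitary_iter_CA n fl); rewrite /comp => <-.
by apply: LR; exists (coordinate g i).
Qed.

Lemma limit_point_exists (l0 : (G -> A) -> K^o) : finitary l0 ->
  (forall n, exists2 x, S x & l0 (iter n t x) != 0) ->
  exists2 y, l0 y = 1 & forall n, exists2 z, S z & iter n t z = y.
Proof.
move=> fl0 l0n.
(* Functionals that become [c] times [l0] on [S] after some iterate are sent to [c]: [l0] to 1, and
   those killed by an iterate to 0. *)
pose R : set (((G -> A) -> K^o) * K) := [set p | exists n, forall x, S x ->
  p.1 (iter n t x) = p.2 * l0 (iter n t x)].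
have gR : functional_graph R.
  split=> [|a [p c] [q d] [n /= pn] [m /= qm]|c [n /= cn]].
  - by exists 0%N => x _ /=; rewrite mul0r.
  - exists (n + m)%N => x Sx /=.
    rewrite !fctE {1 3}iterD pn; last exact: iter_CA_stable.
    rewrite addnC iterD qm; last exact: iter_CA_stable.
    by rewrite -!iterD addnC /GRing.scale/= mulrDl mulrA.
  (* Single-valuedness is where the survival of [l0] under every iterate enters. *)
  - have [x Sx lx] := l0n n; have /esym/eqP := cn x Sx.
    by rewrite mulf_eq0 (negbTE lx) orbF => /eqP.
have [L LR] := functional_graph_extension gR.
have [y Ly] := scalar_finitary_eval L.
exists y; first by rewrite -Ly//; apply: LR; exists 0%N => x _; rewrite mul1r.
move=> n; apply: iter_image_lift => l fl ln.
by rewrite -Ly//; apply: LR; exists n => x Sx /=; rewrite mul0r ln.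
Qed.

Lemma iter_CA_eq0 : (forall g x, S x -> S (shift g x)) ->
  (forall y, (forall n, exists2 z, S z & iter n t z = y) -> y = 0) ->
  exists n, forall x, S x -> iter n t x = 0.
Proof.
move=> Sshift lim0.
have iter_shift n g x : iter n t (shift g x) = shift g (iter n t x).
  by elim: n => //= n ->; rewrite linear_CA_shift.
have /choice[N NP] i : exists n, forall x, S x ->
    coordinate 1%g i (iter n t x) = 0.
  apply: contrapT => /forallNP Ni.
  have [|n|y ly1] := @limit_point_exists (coordinate 1%g i).
  - exact: finitary_coordinate.
  - have /existsNP[x /not_implyP[Sx /eqP lx]] := Ni n.
    by exists x.
  - move=> /lim0 y0; move/eqP: ly1.
    by rewrite y0 /coordinate linear0 eq_sym oner_eq0.
exists (\max_i N i)%N => x Sx; apply: coordinate_inj => g i.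
have -> z : coordinate g i z = coordinate 1%g i (shift g^-1%g z).
  by rewrite /coordinate /shift invgK mulg1.
(* The surplus steps beyond [N i] are performed first; they stay inside [S], where [N i] steps kill
   coordinate [i]. *)
rewrite -iter_shift -[X in iter X](subnKC (leq_bigmax i)) iterD NP.
  by rewrite /coordinate linear0.
exact/iter_CA_stable/Sshift.
Qed.

End LinearCA.

Theorem theorem1p8 (G : groupType) (K : fieldType) (A : vectType K)
    (S : set (G -> A)) (tau : S -> S) :
  linear_sofic S -> linear_CA_on tau ->
  (nilpotent_map tau <-> [set \val x | x in limit_set tau] = [set (0 : G -> A)]).
Proof.
move=> [[Scl Sshift Ssub] _] [t tCA tauE].
have tS x : S x -> S (t x).
  by move=> /mem_set Sx; rewrite -(tauE (exist _ x Sx)); exact/set_mem/valP.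
have iterE n (x : S) : \val (iter n tau x) = iter n t (\val x).
  by elim: n => //= n <-; rewrite tauE.
have iter0 n : iter n t 0 = 0 by elim: n => //= n ->; exact: linear_CA0.
(* The zero configuration is fixed by [tau]; hence it lies in the limit set and is the only possible
   constant value of an iterate. *)
have [S0 _] := Ssub; pose z : S := exist _ 0 S0.
have iterz n : iter n tau z = z by apply: val_inj; rewrite iterE iter0.
have limz : limit_set tau z by move=> n _; exists z.
split=> [[c [n [n1 taun]]]|lim0].
  apply/seteqP; split=> [_ [x xlim <-]|_ ->]; last by exists z.
  have [u _ <-] := xlim n n1.
  have cz : c = z by rewrite -(iterz n) taun.
  by rewrite taun cz.
have [y ylim|n tn] := iter_CA_eq0 Scl Ssub tCA tS Sshift.
  have /mem_set Sy : S y by have [u Su <-] := ylim 0%N.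
  have : [set \val x | x in limit_set tau] y; last by rewrite lim0.
  exists (exist _ y Sy) => // n _; have [u /mem_set Su uy] := ylim n.
  by exists (exist _ u Su) => //; apply: val_inj; rewrite iterE.
(* Nilpotency asks for a positive exponent while [n] may be 0; one more step fixes 0. *)
exists z, n.+1; split => //; apply/funext => x.
by apply: val_inj; rewrite iterE /= tn ?(linear_CA0 tCA)//; exact/set_mem/valP.
Qed.
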